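(* Let $\mathbb K$ be a field, $N\ge 3$ an integer, and let $\mathcal A=A(E,R)$ be an $N$-homogeneous algebra over $\mathbb K$. Then the $N$-complexes $K(\mathcal A)^n$ are acyclic for all $n\ge N-1$ if and only if either $R=0$ or $R=E^{\otimes N}$.
   Context: $\otimes$ is the tensor product over $\mathbb K$. An $N$-homogeneous algebra is $\mathcal A=A(E,R)=T(E)/(R)$, with $E$ a finite-dimensional $\mathbb K$-vector space, $R\subset E^{\otimes N}$ a linear subspace, and $(R)$ the two-sided ideal of the tensor algebra $T(E)$ generated by $R$; it is graded, $\mathcal A=\oplus_{n\ge0}\mathcal A_n$, with $\mathcal A_0=\mathbb K$, $\mathcal A_1=E$. Its dual is $\mathcal A^!=A(E^*,R^\perp)$, where $R^\perp\subset(E^{\otimes N})^*=E^{*\otimes N}$ is the annihilator of $R$. The dual spaces of the homogeneous components of $\mathcal A^!$ are identified with subspaces of tensor powers of $E$: $(\mathcal A^!_n)^*=E^{\otimes n}$ for $n<N$, and $(\mathcal A^!_n)^*=\bigcap_{r+s=n-N}E^{\otimes r}\otimes R\otimes E^{\otimes s}$ for $n\ge N$. The chain $N$-complex $K(\mathcal A)$ is $\oplus_m\mathcal A\otimes(\mathcal A^!_m)^*$ with $N$-differential $d:\mathcal A\otimes(\mathcal A^!_m)^*\to\mathcal A\otimes(\mathcal A^!_{m-1})^*$ induced by $a\otimes(e_1\otimes e_2\otimes\cdots\otimes e_m)\mapsto ae_1\otimes(e_2\otimes\cdots\otimes e_m)$ (with $d=0$ for $m=0$); one has $d^N=0$. It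 splits into the subcomplexes $K(\mathcal A)^n=\oplus_m\mathcal A_{n-m}\otimes(\mathcal A^!_m)^*$, $n\in\mathbb N$, in which $\mathcal A_{n-m}\otimes(\mathcal A^!_m)^*$ is placed in degree $m$. A chain $N$-complex $(\oplus_mE_m,d)$ (with $d:E_m\to E_{m-1}$, $d^N=0$) is acyclic if for all $m\in\mathbb Z$ and all $p\in\{1,\dots,N-1\}$ one has ${}_pH_m:=\mathrm{Ker}(d^p:E_m\to E_{m-p})/\mathrm{Im}(d^{N-p}:E_{m+N-p}\to E_m)=0$. *)

(* Defs.v *)
From HB Require Import structures.
From mathcomp Require Import all_boot all_order all_algebra.
From mathcomp Require Import generic_quotient ring_quotient.
From mathcomp Require Import boolp.
From mathcomp Require Import finmap.
From mathcomp.multinomials Require Import monalg.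

Set Implicit Arguments.
Unset Strict Implicit.
Unset Printing Implicit Defensive.

Import GRing.Theory.
Local Open Scope ring_scope.

(* For S stable under scaling, as in every use below, this is the linear span. *)
Definition sums (V : zmodType) (S : V -> Prop) (x : V) : Prop :=
  exists2 s : seq V, {in s, forall y, S y} & x = \sum_(y <- s) y.

Section Sums.
Variables (V : zmodType) (S : V -> Prop).

Lemma sums0 : sums S 0.
Proof. by exists [::]; rewrite ?big_nil. Qed.

Lemma sums_gen x : S x -> sums S x.
Proof.
by move=> Sx; exists [:: x]; rewrite ?big_seq1 // => y; rewrite inE => /eqP->.
Qed.

Lemma sumsD x y : sums S x -> sums S y -> sums S (x + y).
Proof.
move=> [s Ss ->] [t St ->]; exists (s ++ t); last by rewrite big_cat.
by move=> z; rewrite mem_cat => /orP[/Ss|/St].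
Qed.

Lemma sums_ind (P : V -> Prop) :
  P 0 -> (forall x y, P x -> P y -> P (x + y)) -> (forall x, S x -> P x) ->
  forall x, sums S x -> P x.
Proof.
move=> P0 PD PS x [s Ss ->]; elim: s Ss => [|y s IH] Ss; rewrite ?big_nil //.
rewrite big_cons; apply: PD; first by apply/PS/Ss; rewrite mem_head.
by apply: IH => z zs; apply: Ss; rewrite inE zs orbT.
Qed.
End Sums.

Section TwoSidedQuotient.
Variables (K : fieldType) (T : algType K) (S : {pred T}).

(* The two-sided ideal (S) generated by S. *)
Definition tsideal : {pred T} := fun t =>
  `[< sums (fun u => exists a s b, s \in S /\ u = a * s * b) t >].

Lemma tsidealP t :
  reflect (sums (fun u => exists a s b, s \in S /\ u = a * s * b) t)
          (t \in tsideal).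
Proof. exact: asboolP. Qed.

Lemma tsidealM a b t : t \in tsideal -> a * t * b \in tsideal.
Proof.
move=> /tsidealP tI; apply/tsidealP; move: t tI; apply: sums_ind.
- by rewrite mulr0 mul0r; apply: sums0.
- by move=> x y; rewrite mulrDr mulrDl; apply: sumsD.
- move=> _ [a' [s [b' [Ss ->]]]]; apply: sums_gen.
  by exists (a * a'), s, (b' * b); split=> //; rewrite !mulrA.
Qed.

Lemma tsidealMl a t : t \in tsideal -> a * t \in tsideal.
Proof. by move/(tsidealM a 1); rewrite mulr1. Qed.

Lemma tsidealMr b t : t \in tsideal -> t * b \in tsideal.
Proof. by move/(tsidealM 1 b); rewrite mul1r. Qed.

Lemma tsideal_zmod : zmod_closed tsideal.
Proof.
have D x y : x \in tsideal -> y \in tsideal -> x + y \in tsideal.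
  by move=> /tsidealP xI /tsidealP yI; apply/tsidealP; apply: sumsD.
split=> [|x y xI yI]; first by apply/tsidealP; apply: sums0.
by apply: D => //; rewrite -mulN1r; apply: tsidealMl.
Qed.

HB.instance Definition _ := GRing.isZmodClosed.Build T tsideal tsideal_zmod.

Local Open Scope quotient_scope.

(* T/(S).  It carries pzRingType and lmodType structures, compatible by
   algquot_scalerAl and algquot_scalerAr, rather than an algType one, because
   nothing is required of S and T/(S) may be the null ring.  The operations are
   locked only to keep unification from unfolding them. *)
Definition algquot := Quotient.quot tsideal.

HB.instance Definition _ := GRing.Zmodule.on algquot.

End TwoSidedQuotient.

HB.lock Definition algpi (K : fieldType) (T : algType K) (S : {pred T}) (t : T) :
  algquot S := (\pi_(Quotient.quot (tsideal S)) t)%qT.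

HB.lock Definition algrepr (K : fieldType) (T : algType K) (S : {pred T})
    (x : algquot S) : T := @repr _ (Quotient.quot (tsideal S)) x.

HB.lock Definition aq_mul (K : fieldType) (T : algType K) (S : {pred T})
  (x y : algquot S) : algquot S := algpi S (algrepr x * algrepr y).

HB.lock Definition aq_scale (K : fieldType) (T : algType K) (S : {pred T})
  (c : K) (x : algquot S) : algquot S := algpi S (c *: algrepr x).

Section AlgQuotTheory.
Variables (K : fieldType) (T : algType K) (S : {pred T}).

Local Notation algquot := (algquot S).
Local Notation algpi := (algpi S).
Local Notation tsideal := (tsideal S).
Local Notation aq_mul := (@aq_mul K T S).
Local Notation aq_scale := (@aq_scale K T S).

Lemma algreprK : cancel (@algrepr K T S) algpi.
Proof. by move=> x; rewrite algpi.unlock algrepr.unlock; apply: reprK. Qed.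

Lemma algpi_is_zmod_morphism : zmod_morphism algpi.
Proof. rewrite algpi.unlock; exact: (@pi_is_zmod_morphism _ _ _ (Quotient.quot tsideal)). Qed.

HB.instance Definition _ :=
  GRing.isZmodMorphism.Build T algquot algpi algpi_is_zmod_morphism.

Lemma algpi_eq x y : algpi x = algpi y <-> x - y \in tsideal.
Proof. by rewrite algpi.unlock Quotient.idealrBE; split=> /eqP. Qed.

Lemma algpi_eq0 x : algpi x = 0 <-> x \in tsideal.
Proof. by rewrite -[x in x \in _]subr0 -algpi_eq raddf0. Qed.


Lemma algreprB t : algrepr (algpi t) - t \in tsideal.
Proof. by rewrite -algpi_eq algreprK. Qed.

Lemma algpi_mul x y : aq_mul (algpi x) (algpi y) = algpi (x * y).
Proof.
rewrite unlock; apply/algpi_eq; rewrite -[_ * _](subrK (algrepr (algpi x) * y)) -mulrBr.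
rewrite -addrA -mulrBl; apply: rpredD.
  exact/tsidealMl/algreprB.
exact/tsidealMr/algreprB.
Qed.

Lemma algpi_scale c x : aq_scale c (algpi x) = algpi (c *: x).
Proof.
rewrite unlock; apply/algpi_eq; rewrite -scalerBr -[_ - x]mul1r scalerAl.
by apply: tsidealMl; rewrite algreprB.
Qed.

Let aqE := (algpi_mul, algpi_scale, =^~ raddfD algpi).

Fact aq_mulA : associative aq_mul.
Proof.
by move=> x y z; rewrite -[x]algreprK -[y]algreprK -[z]algreprK !aqE mulrA.
Qed.
Fact aq_mul1x : left_id (algpi 1) aq_mul.
Proof. by move=> x; rewrite -[x]algreprK aqE mul1r. Qed.
Fact aq_mulx1 : right_id (algpi 1) aq_mul.
Proof. by move=> x; rewrite -[x]algreprK aqE mulr1. Qed.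
Fact aq_mulDl : left_distributive aq_mul +%R.
Proof.
by move=> x y z; rewrite -[x]algreprK -[y]algreprK -[z]algreprK !aqE mulrDl.
Qed.
Fact aq_mulDr : right_distributive aq_mul +%R.
Proof.
by move=> x y z; rewrite -[x]algreprK -[y]algreprK -[z]algreprK !aqE mulrDr.
Qed.

HB.instance Definition _ := GRing.Zmodule_isPzRing.Build algquot
  aq_mulA aq_mul1x aq_mulx1 aq_mulDl aq_mulDr.

Fact aq_scaleA a b x : aq_scale a (aq_scale b x) = aq_scale (a * b) x.
Proof. by rewrite -[x]algreprK !aqE scalerA. Qed.
Fact aq_scale1 : left_id 1 aq_scale.
Proof. by move=> x; rewrite -[x]algreprK !aqE scale1r. Qed.
Fact aq_scaleDr : right_distributive aq_scale +%R.
Proof.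
by move=> c x y; rewrite -[x]algreprK -[y]algreprK !aqE scalerDr.
Qed.
Fact aq_scaleDl x : {morph aq_scale^~ x : a b / a + b}.
Proof. by move=> a b /=; rewrite -[x]algreprK !aqE scalerDl. Qed.

HB.instance Definition _ := GRing.Zmodule_isLmodule.Build K algquot
  aq_scaleA aq_scale1 aq_scaleDr aq_scaleDl.

Fact algpi_is_monoid_morphism : monoid_morphism algpi.
Proof. by split=> [//|x y]; rewrite -algpi_mul. Qed.

HB.instance Definition _ :=
  GRing.isMonoidMorphism.Build T algquot algpi algpi_is_monoid_morphism.

Fact algpi_is_scalable : scalable algpi.
Proof. by move=> c x; rewrite -algpi_scale. Qed.

HB.instance Definition _ :=
  GRing.isScalable.Build K T algquot *:%R algpi algpi_is_scalable.

Lemma algquot_scalerAl c (x y : algquot) : c *: (x * y) = (c *: x) * y.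
Proof.
rewrite -[x]algreprK -[y]algreprK -rmorphM.
by rewrite -!(linearZ_LR algpi) -rmorphM scalerAl.
Qed.

Lemma algquot_scalerAr c (x y : algquot) : c *: (x * y) = x * (c *: y).
Proof.
rewrite -[x]algreprK -[y]algreprK -rmorphM.
by rewrite -!(linearZ_LR algpi) -rmorphM scalerAr.
Qed.
End AlgQuotTheory.

Lemma malg_scalerAr (R : comNzRingType) (M : monomType) (c : R)
  (x y : {malg R[M]}) : c *: (x * y) = x * (c *: y).
Proof.
apply/malgP => k; rewrite mcoeffZ mcoeffMl.
rewrite (mcoeffMlw _ (fsubset_refl _) (msuppZ_le c y)) mulr_sumr.
apply: eq_bigr => k1 _; rewrite mulr_sumr; apply: eq_bigr => k2 _.
by rewrite mcoeffZ mulrnAr mulrCA.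
Qed.

Lemma malg_wordE (R : comNzRingType) (M : choiceType) (x : {malg R[M]}) :
  x = \sum_(w <- msupp x) x@_w *: << w >>.
Proof.
rewrite [LHS]monalgE; apply: eq_bigr => w _.
by apply/malgP => k; rewrite mcoeffZ !mcoeffU mulr_natr.
Qed.

(* T(E) is realised as the free algebra on the basis vbasis {:E} of E: the
   monomials are the words in the indices of the basis, multiplied by
   concatenation.  The inclusion of E is tensvec, and tensalg_universal shows
   that this is the tensor algebra of E. *)
Definition tensalg (K : fieldType) (E : vectType K) :=
  {malg K[{fmonom 'I_(\dim {:E})}]}.

HB.instance Definition _ K E := GRing.Lmodule.on (@tensalg K E).

(* The product of {malg K[_]}, locked to keep unification from unfolding it. *)
HB.lock Definition tensmul (K : fieldType) (E : vectType K)
    (x y : tensalg E) : tensalg E :=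
  (x : {malg K[{fmonom 'I_(\dim {:E})}]}) * y.

Section TensorAlgebra.
Variables (K : fieldType) (E : vectType K).

Local Notation malgE := {malg K[{fmonom 'I_(\dim {:E})}]}.
Local Notation tensalg := (tensalg E).
Local Notation tensmul := (@tensmul K E).

Fact tensmulA : associative tensmul.
Proof. by move=> x y z; rewrite unlock; apply: (mulrA (x : malgE)). Qed.
Fact tensmul1l : left_id (1 : malgE) tensmul.
Proof. by move=> x; rewrite unlock; apply: (mul1r (x : malgE)). Qed.
Fact tensmul1r : right_id (1 : malgE) tensmul.
Proof. by move=> x; rewrite unlock; apply: (mulr1 (x : malgE)). Qed.
Fact tensmulDl : left_distributive tensmul +%R.
Proof. by move=> x y z; rewrite unlock; apply: (mulrDl (x : malgE)). Qed.
Fact tensmulDr : right_distributive tensmul +%R.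
Proof. by move=> x y z; rewrite unlock; apply: (mulrDr (x : malgE)). Qed.
Fact tens1_neq0 : (1 : malgE) != 0.
Proof. exact: oner_neq0. Qed.

HB.instance Definition _ := GRing.Zmodule_isNzRing.Build tensalg
  tensmulA tensmul1l tensmul1r tensmulDl tensmulDr tens1_neq0.

Fact tensmul_scaleAl c (x y : tensalg) : c *: tensmul x y = tensmul (c *: x) y.
Proof. by rewrite unlock; apply: (@scalerAl K malgE). Qed.

HB.instance Definition _ :=
  GRing.Lmodule_isLalgebra.Build K tensalg tensmul_scaleAl.

Fact tensmul_scaleAr c (x y : tensalg) : c *: tensmul x y = tensmul x (c *: y).
Proof.
by rewrite unlock; apply: (@malg_scalerAr K).
Qed.

HB.instance Definition _ :=
  GRing.Lalgebra_isAlgebra.Build K tensalg tensmul_scaleAr.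

Lemma tensmulE (x y : tensalg) : x * y = (x : malgE) * (y : malgE).
Proof. by rewrite -[LHS]/(tensmul x y) unlock. Qed.

Definition tensX (i : 'I_(\dim {:E})) : tensalg := << fmu i >>.

Definition tensvec (e : E) : tensalg :=
  \sum_i coord (vbasis {:E}) i e *: tensX i.

Fact tensvec_is_linear : linear tensvec.
Proof.
move=> c u v; rewrite /tensvec scaler_sumr -big_split /=.
by apply: eq_bigr => i _; rewrite linearP scalerDl scalerA.
Qed.

HB.instance Definition _ :=
  GRing.isLinear.Build K E tensalg *:%R tensvec tensvec_is_linear.

Lemma tensvec_basis (i : 'I_(\dim {:E})) : tensvec (vbasis {:E})`_i = tensX i.
Proof.
rewrite /tensvec (bigD1 i) //= coord_free ?(basis_free (vbasisP _)) //.
rewrite eqxx scale1r big1 ?addr0 // => j neq_ji.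
by rewrite coord_free ?(basis_free (vbasisP _)) // eq_sym (negPf neq_ji) scale0r.
Qed.

Lemma word_cons i (w : seq 'I_(\dim {:E})) :
  FMonom (i :: w) = mmul (fmu i) (FMonom w).
Proof. by apply/val_inj; rewrite /= fmM fmU. Qed.

Lemma tensX_word i w : << FMonom (i :: w) >> = tensX i * << FMonom w >>.
Proof. by rewrite tensmulE word_cons malgM_def fgmulUU mulr1. Qed.

Lemma word_prod (w : {fmonom 'I_(\dim {:E})}) :
  << w >> = \prod_(i <- w) tensX i :> tensalg.
Proof.
case: w => w /=; elim: w => [|i w IH]; last by rewrite big_cons -IH tensX_word.
by rewrite big_nil; congr << _ >>; apply/val_inj; rewrite /= fm1.
Qed.

Lemma tensalg_wordE (t : tensalg) : t = \sum_(w <- msupp t) t@_w *: << w >>.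
Proof. exact: malg_wordE. Qed.

Lemma tensalg_universal (B : algType K) (f : {linear E -> B}) :
  exists! g : tensalg -> B,
    [/\ linear g, monoid_morphism g & forall e, g (tensvec e) = f e].
Proof.
pose h (w : {fmonom 'I_(\dim {:E})}) :=
  \prod_(i <- w) f (vbasis {:E})`_(i : 'I_(\dim {:E})).
have hM : mmorphism h.
  by split=> [x y|]; rewrite /h ?fm1 ?big_nil // fmM big_cat.
pose hm : {mmorphism _ -> B} := HB.pack h (isMultiplicative.Build _ _ h hM).
pose g : tensalg -> B := mmap (in_alg B) hm.
have [gM g1] : multiplicative (g : malgE -> B).
  apply: commr_mmap_is_multiplicative => t m m'.
  by rewrite /GRing.comm mulr_algl mulr_algr.
have gL : linear g.
  by move=> c x y; rewrite /g mmapD mmapZ mulr_algl.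
have gX i : g (tensX i) = f (vbasis {:E})`_i.
  by rewrite /g mmapU /= scale1r mul1r /h fmU big_seq1.
exists g; split.
  split=> // [|e]; first by split=> // x y; rewrite tensmulE gM.
  pose gl : {linear tensalg -> B} :=
    HB.pack g (GRing.isLinear.Build _ _ _ _ g gL).
  rewrite -[g]/(gl : _ -> _) [in RHS](coord_vbasis (memvf e)) !linear_sum.
  by apply: eq_bigr => i _; rewrite !linearZ; congr (_ *: _); apply: gX.
move=> g' [g'L [g'1 g'M] g'f]; apply: funext => t.
pose gl : {linear tensalg -> B} :=
    HB.pack g (GRing.isLinear.Build _ _ _ _ g gL).
pose gl' : {linear tensalg -> B} :=
    HB.pack g' (GRing.isLinear.Build _ _ _ _ g' g'L).
rewrite -[g]/(gl : _ -> _) -[g']/(gl' : _ -> _).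
rewrite (tensalg_wordE t) !linear_sum; apply: eq_bigr => w _.
rewrite !linearZ word_prod; congr (_ *: _); rewrite /=.
elim: (w : seq _) => [|i v IH]; first by rewrite big_nil g1 g'1.
by rewrite big_cons g'M {1}tensmulE gM IH gX -tensvec_basis g'f.
Qed.

(* E^{(x) n}: the span of the products of n vectors of E, see tpow_spanP. *)
Definition tpow (n : nat) : {pred tensalg} :=
  fun t => all (fun w : {fmonom _} => fdeg w == n) (msupp t).

Lemma tpowP n (t : tensalg) :
  reflect (forall w : {fmonom _}, fdeg w != n -> t@_w = 0) (t \in tpow n).
Proof.
apply: (iffP allP) => [h w wn|h w]; last first.
  by rewrite -mcoeff_neq0; apply: contraNT => /h ->.
by apply: mcoeff_outdom; apply: contraNN wn => /h.
Qed.

Fact tpow_submod n : submod_closed (tpow n).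
Proof.
split; first by apply/tpowP => w _; rewrite mcoeff0.
move=> c x y /tpowP xn /tpowP yn; apply/tpowP => w wn.
by rewrite mcoeffD mcoeffZ xn ?yn // mulr0 addr0.
Qed.

HB.instance Definition _ n :=
  GRing.isSubmodClosed.Build K tensalg (tpow n) (tpow_submod n).

Lemma tpow_word (w : {fmonom _}) : << w >> \in tpow (fdeg w).
Proof.
by apply/tpowP => v; rewrite mcoeffU; case: (eqVneq w v) => // ->; rewrite eqxx.
Qed.

Lemma tpowM m n x y : x \in tpow m -> y \in tpow n -> x * y \in tpow (m + n).
Proof.
move=> /allP xm /allP yn; apply/allP => w.
rewrite tensmulE => /msuppM_le[u [v [/xm um /yn vn ->]]].
by rewrite fdegM (eqP um) (eqP vn).
Qed.

Lemma tpow_spanP n (t : tensalg) :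
  t \in tpow n <-> sums (fun u => exists (c : K) (e : n.-tuple E),
                          u = c *: \prod_(x <- e) tensvec x) t.
Proof.
have vec1 e : tensvec e \in tpow 1.
  rewrite rpred_sum // => i _; rewrite rpredZ //.
  by have := tpow_word (fmu i); rewrite fdegU.
split=> [tn|].
  rewrite (tensalg_wordE t) big_seq.
  apply: (big_ind (sums _)) => [||w wt]; [exact: sums0|exact: sumsD|].
  apply: sums_gen; have /eqP wn := allP tn w wt.
  have sz : size [seq (vbasis {:E})`_(i : 'I_(\dim {:E})) | i <- w] == n.
    by rewrite size_map -wn.
  exists t@_w, (Tuple sz); rewrite word_prod /= big_map; congr (_ *: _).
  by apply: eq_bigr => i _; rewrite tensvec_basis.
move: t; apply: sums_ind; [exact: rpred0|exact: rpredD|].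
move=> _ [c [e ->]].
suff: \prod_(x <- e) tensvec x \in tpow (size e).
  by rewrite size_tuple; apply: rpredZ.
elim: (e : seq E) => [|x s IH].
  by rewrite big_nil; have := tpow_word mone; rewrite fdeg1.
by rewrite big_cons; apply: (@tpowM 1).
Qed.

End TensorAlgebra.

Arguments tpow {K} E n.

(* A Z-graded chain N-complex is given by a map d on an ambient group V and by
   the homogeneous components C m of V. *)
Definition nchain_complex (N : nat) (V : zmodType) (C : int -> V -> Prop)
    (d : V -> V) : Prop :=
  forall (m : int) (x : V), C m x -> C (m - 1) (d x) /\ iter N d x = 0.

(* Ker (d^p : C_m -> C_{m-p}) = Im (d^{N-p} : C_{m+N-p} -> C_m) for 0 < p < N;
   one inclusion is part of d^N = 0. *)
Definition acyclic (N : nat) (V : zmodType) (C : int -> V -> Prop)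
    (d : V -> V) : Prop :=
  forall (m : int) (p : nat), (0 < p < N)%N ->
  forall x : V, C m x -> iter p d x = 0 ->
  exists2 y : V, C (m + (N - p)%N%:Z) y & iter (N - p) d y = x.

Lemma mcoeff_sumU (M : choiceType) (B : zmodType) (d : {fset M}) (F : M -> B) w :
  (\sum_(k <- d) << F k *g k >>)@_w = if w \in d then F w else 0.
Proof.
rewrite raddf_sum /=; case: ifP => wd.
  rewrite (big_fsetD1 w) //= mcoeffUU big1_fset ?addr0 // => v.
  by rewrite in_fsetD1 => /andP[vw _] _; rewrite mcoeffU (negPf vw).
rewrite big1_fset // => v vd _.
by rewrite mcoeffU; case: eqP wd => // <-; rewrite vd.
Qed.

Lemma mcoeff_sum_behead (g : nat) (B : zmodType) (F : 'I_g -> B -> B)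
    (f : {malg B[{fmonom 'I_g}]}) w : (forall i, F i 0 = 0) ->
  (\sum_(u <- msupp f)
     if (u : seq _) is i :: v then << F i f@_u *g FMonom v >> else 0)@_w
  = \sum_i F i f@_(FMonom (i :: w)).
Proof.
move=> F0; rewrite raddf_sum /=.
transitivity (\sum_(v <- msupp f) \sum_i
  F i f@_(FMonom (i :: w)) *+ (v == FMonom (i :: w))).
  apply: eq_bigr => -[[|i v]] _ /=.
    by rewrite mcoeff0 big1 // => i _; rewrite mulr0n.
  rewrite mcoeffU (bigD1 i) //= big1 ?addr0 => [|j ji].
    rewrite -2!val_eqE /= eqseq_cons eqxx /=.
    by case: eqP => // ->; case: w.
  by rewrite -val_eqE /= eqseq_cons eq_sym (negPf ji).
rewrite exchange_big /=; apply: eq_bigr => i _.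
have [wt|wt] := boolP (FMonom (i :: w) \in msupp f).
  rewrite (big_fsetD1 _ wt) /= eqxx big1_fset ?addr0 // => v.
  by rewrite in_fsetD1 => /andP[/negPf-> _].
rewrite mcoeff_outdom // F0 big1_fset // => v vt _.
by rewrite mul0rn.
Qed.

(* A (x) T(E), with A = T(E)/(R), as the finitely supported A-valued functions
   on words. *)
Definition algtens (K : fieldType) (E : vectType K) (R : {pred tensalg E}) :=
  {malg (algquot R)[{fmonom 'I_(\dim {:E})}]}.

HB.instance Definition _ K E R := GRing.Zmodule.on (@algtens K E R).

HB.lock Definition tens (K : fieldType) (E : vectType K) (R : {pred tensalg E})
    (a : algquot R) (t : tensalg E) : algtens R :=
  \sum_(w <- msupp t) << t@_w *: a *g w >>.

(* d (a (x) (e_1 (x) ... (x) e_m)) = a e_1 (x) (e_2 (x) ... (x) e_m), written on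
   the words in the basis of E; see koszul_d_tens and koszul_d_tens1. *)
HB.lock Definition koszul_d (K : fieldType) (E : vectType K)
    (R : {pred tensalg E}) (f : algtens R) : algtens R :=
  \sum_(w <- msupp f)
    if (w : seq _) is i :: v then << f@_w * algpi R (tensX i) *g FMonom v >>
    else 0.

(* t = \sum_i tensX i * tensdiv i t when t has no constant term. *)
HB.lock Definition tensdiv (K : fieldType) (E : vectType K)
    (i : 'I_(\dim {:E})) (t : tensalg E) : tensalg E :=
  \sum_(w <- msupp t)
    if (w : seq _) is j :: v then << t@_w *+ (j == i) *g FMonom v >> else 0.

Section Koszul.
Variables (K : fieldType) (E : vectType K) (N : nat) (R : {pred tensalg E}).

Notation T := (tensalg E).
Notation A := (algquot R).
Notation I := 'I_(\dim {:E}).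

(* A_n, the image of E^{(x) n} in A. *)
Definition algcomp (n : nat) (a : A) : Prop :=
  exists2 t : T, t \in tpow E n & a = algpi R t.

(* E^{(x) r} (x) R (x) E^{(x) s} as a subspace of E^{(x) (r + N + s)}. *)
Definition tpow_sandwich (r s : nat) : T -> Prop :=
  sums (fun u => exists a b c : T,
    [/\ a \in tpow E r, b \in R, c \in tpow E s & u = a * b * c]).

(* (A^!_n)^*, where A^! = A(E^*, R^perp), under its standard identification with
   a subspace of E^{(x) n}. *)
Definition dualcomp (n : nat) (t : T) : Prop :=
  if (n < N)%N then is_true (t \in tpow E n)
  else forall r s : nat, (r + s = n - N)%N -> tpow_sandwich r s t.

(* The component A_{n-m} (x) (A^!_m)^* of degree m of K(A)^n.  As K is a field,
   this tensor product is identified with its image in A (x) T(E).  It is 0 when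
   m > n or m < 0. *)
Definition koszul (n : nat) (m : int) : algtens R -> Prop :=
  if m is Posz m then
    if (m <= n)%N then
      sums (fun f => exists a t,
        [/\ algcomp (n - m) a, dualcomp m t & f = tens a t])
    else fun f => f = 0
  else fun f => f = 0.

Lemma tensE (a : A) t w : (tens a t)@_w = t@_w *: a.
Proof.
rewrite unlock mcoeff_sumU; case: ifPn => // /mcoeff_outdom ->.
by rewrite scale0r.
Qed.

Lemma koszul_dE (f : algtens R) w :
  (koszul_d f)@_w = \sum_i f@_(FMonom (i :: w)) * algpi R (tensX i).
Proof.
rewrite unlock (mcoeff_sum_behead (F := fun i b => b * algpi R (tensX i))) // => i.
exact: mul0r.
Qed.

Fact koszul_d_is_zmod_morphism : zmod_morphism (@koszul_d _ _ R).
Proof.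
move=> f g; apply/malgP => w.
rewrite mcoeffB !koszul_dE -sumrB.
by apply: eq_bigr => i _; rewrite mcoeffB mulrBl.
Qed.

HB.instance Definition _ :=
  GRing.isZmodMorphism.Build (algtens R) (algtens R) (@koszul_d _ _ R) koszul_d_is_zmod_morphism.

Lemma tensdivE i (t : T) w : (tensdiv i t)@_w = t@_(FMonom (i :: w)).
Proof.
rewrite unlock (mcoeff_sum_behead (F := fun j b => b *+ (j == i))) => [|j].
  by rewrite (bigD1 i) //= eqxx big1 ?addr0 // => j /negPf->.
exact: mul0rn.
Qed.

Fact tensdiv_is_linear i : linear (@tensdiv K E i).
Proof.
move=> c x y; apply/malgP => w.
by rewrite tensdivE !mcoeffD !mcoeffZ !tensdivE.
Qed.

HB.instance Definition _ i := GRing.isLinear.Build K T T *:%R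
  (@tensdiv K E i) (tensdiv_is_linear i).

Lemma tensdivX i j (t : T) : tensdiv i (tensX j * t) = t *+ (j == i).
Proof.
apply/malgP => -[w]; rewrite tensdivE mcoeffMn.
rewrite {1}(tensalg_wordE t) mulr_sumr raddf_sum /=.
rewrite [in RHS](tensalg_wordE t) raddf_sum /= -sumrMnl.
apply: eq_bigr => -[v] _; rewrite -scalerAr -tensX_word !mcoeffZ !mcoeffU.
rewrite -2!val_eqE /= eqseq_cons -mulrnAr; congr (_ * _).
by case: (j == i); rewrite ?mulr1n ?mulr0n.
Qed.

Lemma koszul_d_tens1 (a : A) : koszul_d (tens a 1) = 0.
Proof.
apply/malgP => -[w]; rewrite koszul_dE mcoeff0 big1 // => i _.
by rewrite tensE mcoeff1 -val_eqE /= fm1 scale0r mul0r.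
Qed.

Lemma iter_koszul_d_sum (p : nat) (J : Type) (r : seq J) (F : J -> algtens R) :
  iter p (@koszul_d K E R) (\sum_(j <- r) F j)
  = \sum_(j <- r) iter p (@koszul_d K E R) (F j).
Proof. by elim: p => //= p ->; rewrite raddf_sum. Qed.

Lemma koszul_d_tensdiv (a : A) t :
  koszul_d (tens a t) = \sum_i tens (a * algpi R (tensX i)) (tensdiv i t).
Proof.
apply/malgP => -[w]; rewrite koszul_dE raddf_sum; apply: eq_bigr => i _ /=.
by rewrite !tensE tensdivE algquot_scalerAl.
Qed.

Lemma koszul_d_tens (a : A) (e : E) t :
  koszul_d (tens a (tensvec e * t)) = tens (a * algpi R (tensvec e)) t.
Proof.
apply/malgP => w; rewrite koszul_d_tensdiv raddf_sum /= [in RHS]tensE.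
rewrite [in RHS]/tensvec raddf_sum mulr_sumr scaler_sumr.
apply: eq_bigr => i _; rewrite tensE.
have -> : tensdiv i (tensvec e * t) = coord (vbasis {:E}) i e *: t.
  rewrite /tensvec mulr_suml linear_sum.
  transitivity (\sum_j coord (vbasis {:E}) j e *: (t *+ (j == i))).
    by apply: eq_bigr => j _; rewrite -scalerAl linearZ_LR /= tensdivX.
  rewrite (bigD1 i isT) /= eqxx mulr1n big1 ?addr0 // => j /negPf->.
  by rewrite mulr0n scaler0.
by rewrite mcoeffZ /= linearZ_LR -algquot_scalerAr scalerA mulrC.
Qed.

Lemma tensX_tpow i : tensX i \in tpow E 1.
Proof. by have := tpow_word (fmu i); rewrite fdegU. Qed.

Lemma tensdiv_tpow i n (t : T) : t \in tpow E n.+1 -> tensdiv i t \in tpow E n.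
Proof. by move=> /tpowP tn; apply/tpowP => w wn; rewrite tensdivE tn. Qed.

Lemma tensdiv_tpow0 i (t : T) : t \in tpow E 0 -> tensdiv i t = 0.
Proof. by move=> /tpowP t0; apply/malgP => w; rewrite tensdivE t0 ?mcoeff0. Qed.

Lemma tensdiv_sum n (t : T) : t \in tpow E n.+1 ->
  t = \sum_i tensX i * tensdiv i t.
Proof.
move=> tn; have sn : \sum_i tensX i * tensdiv i t \in tpow E n.+1.
  apply: (big_ind (fun x => x \in tpow E n.+1)); [exact: rpred0|exact: rpredD|].
  by move=> i _; apply/(tpowM (tensX_tpow i))/tensdiv_tpow.
apply/malgP => -[[|j w]]; first by rewrite (tpowP _ _ tn) ?(tpowP _ _ sn).
rewrite -!(tensdivE j _ (FMonom w)) raddf_sum (bigD1 j isT) /= tensdivX eqxx.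
by rewrite big1 => [|i /negPf ij]; [rewrite addr0|rewrite tensdivX ij].
Qed.

Lemma tensdivM i n (a t : T) : a \in tpow E n.+1 ->
  tensdiv i (a * t) = tensdiv i a * t.
Proof.
move=> /tensdiv_sum {1}->; rewrite mulr_suml raddf_sum (bigD1 i isT) /=.
rewrite -mulrA tensdivX eqxx big1 => [|j /negPf ji]; first by rewrite addr0.
by rewrite -mulrA tensdivX ji.
Qed.

Lemma tensdiv_dualcomp i m t : {subset R <= tpow E N} ->
  dualcomp m.+1 t -> dualcomp m (tensdiv i t).
Proof.
move=> RN; have sandwichN r s u :
    tpow_sandwich r s u -> u \in tpow E (r + N + s).
  move: u; apply: sums_ind; [exact: rpred0|exact: rpredD|].
  by move=> _ [a [b [c [ar /RN bR cs ->]]]]; rewrite !tpowM.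
rewrite /dualcomp; case: (ltnP m.+1 N) => [mN|Nm].
  by rewrite ltnW //; apply: tensdiv_tpow.
move=> H; case: ltnP => [mN|Nm' r s rs].
  apply: tensdiv_tpow; have -> : m.+1 = (0 + N + (m.+1 - N))%N.
    by rewrite add0n subnKC.
  exact/sandwichN/H.
have: tpow_sandwich r.+1 s t by apply: H; rewrite addSn rs subSn.
move: t {H}; apply: sums_ind => [|x y Hx Hy|_ [a [b [c [ar bR cs ->]]]]].
- suff -> : tensdiv i (0 : T) = 0 by apply: sums0.
  by apply/malgP => w; rewrite tensdivE !mcoeff0.
- suff -> : tensdiv i (x + y) = tensdiv i x + tensdiv i y by apply: sumsD.
  by apply/malgP => w; rewrite mcoeffD !tensdivE mcoeffD.
- apply: sums_gen; exists (tensdiv i a), b, c; split=> //.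
    exact: tensdiv_tpow.
  by rewrite -[a * b * c]mulrA -[RHS]mulrA; apply: tensdivM ar.
Qed.

Lemma iter_koszul_d n (a : A) u t : u \in tpow E n ->
  iter n (@koszul_d K E R) (tens a (u * t)) = tens (a * algpi R u) t.
Proof.
elim: n a u t => [|n IH] a u t un.
  have {un}-> : u = u@_mone *: 1.
    apply/malgP => w; rewrite mcoeffZ mcoeff1; have [->|w1] := eqVneq w mone.
      by rewrite mulr1.
    by move/tpowP: un => ->; rewrite ?mulr0 // fdeg_eq0.
  apply/malgP => w; rewrite /= !tensE -scalerAl mul1r mcoeffZ linearZ /=.
  by rewrite rmorph1 -algquot_scalerAr mulr1 scalerA mulrC.
rewrite iterSr koszul_d_tensdiv iter_koszul_d_sum.
transitivity (\sum_i tens (a * algpi R (tensX i) * algpi R (tensdiv i u)) t).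
  apply: eq_bigr => i _; rewrite (tensdivM i t un); apply: IH.
  exact: tensdiv_tpow.
apply/malgP => w; rewrite raddf_sum /= tensE [in RHS](tensdiv_sum un) raddf_sum.
rewrite mulr_sumr scaler_sumr; apply: eq_bigr => i _.
by rewrite tensE /= rmorphM mulrA.
Qed.

Lemma koszul_nchain_complex n : (0 < N)%N -> {subset R <= tpow E N} ->
  nchain_complex N (koszul n) (@koszul_d K E R).
Proof.
move=> N_gt0 RN [m|m] f /=; last first.
  by move=> ->; rewrite raddf0; split=> //; elim: (N) => //= p ->; rewrite raddf0.
have it0 p : iter p (@koszul_d K E R) 0 = 0.
  by elim: p => //= p ->; rewrite raddf0.
have k0 l : koszul n l 0.
  by case: l => [l|l] //=; case: ifP => // _; apply: sums0.
case: ifP => [mn|_ ->]; last by rewrite raddf0.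
have kD l x y : koszul n l x -> koszul n l y -> koszul n l (x + y).
  case: l => [l|l] /=; last by move=> -> ->; rewrite addr0.
  by case: ifP => _; [apply: sumsD|move=> -> ->; rewrite addr0].
move: f; apply: sums_ind => [|x y [Cx x0] [Cy y0]|].
- by rewrite raddf0.
- split; first by rewrite raddfD; apply: kD.
  have := iter_koszul_d_sum N [:: x; y] id.
  by rewrite !big_cons !big_nil !addr0 => ->; rewrite x0 y0 addr0.
have tens0 (b : A) : tens b 0 = 0.
  by apply/malgP => w; rewrite tensE !mcoeff0 scale0r.
move=> _ [a [t [[u un ->] mt ->]]]; split.
  rewrite koszul_d_tensdiv; apply: (big_ind (koszul n (m%:Z - 1))) => // [|i _].
    exact: kD.
  case: m mn un mt => [|m] mn un mt.
    by rewrite tensdiv_tpow0 ?tens0 //; move: mt; rewrite /dualcomp N_gt0.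
  rewrite intS addrC addKr /= ltnW //; apply: sums_gen.
  exists (algpi R u * algpi R (tensX i)), (tensdiv i t); split=> //.
    exists (u * tensX i); rewrite ?rmorphM //.
    have -> : (n - m)%N = (n - m.+1 + 1)%N by rewrite addn1 subnSK.
    exact/tpowM/tensX_tpow.
  exact: tensdiv_dualcomp.
move: mt; rewrite /dualcomp; case: ltnP => [mN tm|Nm /(_ 0%N (m - N)%N erefl)].
  rewrite -(subnK mN) iterD iterS -[t]mulr1 (iter_koszul_d _ _ tm).
  by rewrite koszul_d_tens1 it0.
move: t; apply: sums_ind => [|x y Hx Hy|_ [b [c [e [b0 cR _ ->]]]]].
- by rewrite tens0.
- have -> : tens (algpi R u) (x + y) = \sum_(z <- [:: x; y]) tens (algpi R u) z.
    rewrite !big_cons big_nil addr0; apply/malgP => w.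
    by rewrite mcoeffD !tensE mcoeffD scalerDl.
  by rewrite iter_koszul_d_sum !big_cons big_nil Hx Hy !addr0.
have bc : b * c \in tpow E N by apply: (@tpowM _ _ 0) => //; apply: RN.
rewrite (iter_koszul_d _ _ bc) (_ : algpi R (b * c) = 0) ?mulr0.
  by apply/malgP => w; rewrite tensE mcoeff0 scaler0.
by apply/algpi_eq0/tsidealP/sums_gen; exists b, c, 1; rewrite mulr1.
Qed.
End Koszul.

Arguments koszul {K E} N R n m f.
Arguments koszul_d {K E R} f.

(* Main.v *)
(* In K(A)^n, every element of degree m is d^(n-m) (1 (x) t) for some t in
   E^(x)n, and t is unique as long as n - m < N, because the ideal (R) lives in
   degrees >= N.  When R = 0 or R = E^(x)N, every component of K(A)^n is
   therefore either 0 or a copy of E^(x)n, and d is the identity between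
   consecutive copies.

   Conversely, already the exactness of K(A)^(N+1) in degree N - 1 with p = N - 1
   gives RE + ER = ER inside E^(x)(N+1), since A_2 = E^(x)2 for N >= 3.  Iterating
   R (x) E <= E (x) R gives R (x) E^(x)N <= E^(x)N (x) R, and contracting the
   first N factors of r (x) x, for r <> 0 in R, puts every x of E^(x)N in R. *)
Require Import Defs.
From mathcomp Require Import all_boot all_order all_algebra.
From mathcomp Require Import boolp finmap.
From mathcomp.multinomials Require Import monalg.

Set Implicit Arguments.
Unset Strict Implicit.
Unset Printing Implicit Defensive.

Import GRing.Theory.
Local Open Scope ring_scope.

(** * Splitting tensors into leading and trailing factors *)

Section TensorPowers.
Variables (K : fieldType) (E : vectType K).
Implicit Types (t u v : tensalg E).

Lemma tpow1 : (1 : tensalg E) \in tpow E 0.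
Proof. by have := tpow_word (mone : {fmonom 'I_(\dim {:E})}); rewrite fdeg1. Qed.

Lemma tpow0_scalar u : u \in tpow E 0 -> u = u@_mone *: 1.
Proof.
move=> /tpowP u0; apply/malgP => w; rewrite mcoeffZ mcoeff1.
have [->|w1] := eqVneq w mone; first by rewrite mulr1.
by rewrite u0 ?mulr0 // fdeg_eq0.
Qed.

Lemma tpow_split m n t : t \in tpow E (m + n) ->
  sums (fun z => exists u v, [/\ u \in tpow E m, v \in tpow E n & z = u * v]) t.
Proof.
elim: m t => [|m IH] t tn.
  by apply: sums_gen; exists 1, t; rewrite tpow1 mul1r.
rewrite (tensdiv_sum tn); apply: big_ind => [|x y|i _].
- exact: sums0.
- exact: sumsD.
have := IH _ (tensdiv_tpow i tn); move: (tensdiv i t).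
apply: sums_ind => [|x y Hx Hy|_ [u [v [um vn ->]]]].
- by rewrite mulr0; apply: sums0.
- by rewrite mulrDr; apply: sumsD.
apply: sums_gen; exists (tensX i * u), v; split=> //; last by rewrite mulrA.
exact: (tpowM (tensX_tpow i)).
Qed.

(* For t in E^(x)(k + m), t = \sum_w tenslead k t w * << w >>, over the words w
   of length m. *)
Fixpoint tenslead (k : nat) t (w : {fmonom 'I_(\dim {:E})}) : tensalg E :=
  if k is k'.+1 then \sum_i tensX i * tenslead k' (tensdiv i t) w else t@_w *: 1.

Lemma tenslead_tpow k t w : tenslead k t w \in tpow E k.
Proof.
elim: k t => [|k IH] t /=; first by rewrite rpredZ ?tpow1.
apply: rpred_sum => i _; exact: (tpowM (tensX_tpow i)).
Qed.

(** Stripping a first letter [i] from [tenslead k.+1 t w] leaves [tenslead k (tensdiv i t) w], so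
    the vanishing descends to each [tensdiv i t], and these rebuild [t]. *)
Lemma tenslead_eq0 k m t : t \in tpow E (k + m) ->
  (forall w, tenslead k t w = 0) -> t = 0.
Proof.
elim: k t => [|k IH] t tkm t0.
  apply/malgP => w; have /(congr1 (mcoeff mone)) := t0 w.
  by rewrite mcoeffZ mcoeff1 eqxx mulr1 !mcoeff0.
rewrite (tensdiv_sum tkm) big1 // => i _.
rewrite [tensdiv i t]IH ?mulr0 ?(tensdiv_tpow _ tkm) // => w.
have := congr1 (tensdiv i) (t0 w); rewrite /= !raddf_sum /= (bigD1 i) //=.
rewrite tensdivX eqxx mulr1n big1 ?addr0 => [->|j /negPf ji].
  by rewrite raddf0.
by rewrite tensdivX ji.
Qed.

End TensorPowers.

(** * Lifting elements of K(A)^n to E^(x)n *)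

Section KoszulComplex.
Variables (K : fieldType) (E : vectType K) (N : nat) (R : {pred tensalg E}).
Hypothesis R_homog : {subset R <= tpow E N}.
Local Notation d := (@koszul_d K E R).
Implicit Types (t u v : tensalg E) (f g : algtens R).

Lemma tsideal_low k t : (k < N)%N -> t \in tsideal R -> t \in tpow E k -> t = 0.
Proof.
move=> kN /tsidealP tI /tpowP tk; apply/malgP => w; rewrite mcoeff0.
have [wk|] := eqVneq (fdeg w) k; last exact: tk.
(* The summands a s b of [t] need not be homogeneous, so the induction runs on coefficients: every
   word of a s b contains a word of s, of length N. *)
suff: forall w : {fmonom 'I_(\dim {:E})}, (fdeg w < N)%N -> t@_w = 0.
  by apply; rewrite wk.
move: t tI {tk w wk}; apply: sums_ind => [w _|x y Hx Hy w wN|].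
- exact: mcoeff0.
- by rewrite mcoeffD Hx ?Hy ?addr0.
move=> _ [a [s [b [/R_homog/allP sN ->]]]] w; rewrite ltnNge => wN.
apply: mcoeff_outdom; apply: contra wN; rewrite tensmulE.
move=> /msuppM_le[u [v [+ _ ->]]]; rewrite tensmulE.
move=> /msuppM_le[u1 [u2 [_ /sN/eqP u2N ->]]].
by rewrite !fdegM u2N -addnA addnCA leq_addr.
Qed.

Lemma tensDr a t u : tens a (t + u) = tens a t + tens a u :> algtens R.
Proof. by apply/malgP => w; rewrite mcoeffD !tensE mcoeffD scalerDl. Qed.

Lemma tens0r a : tens a 0 = 0 :> algtens R.
Proof. by apply/malgP => w; rewrite tensE !mcoeff0 scale0r. Qed.

Lemma iter_koszul_dD p f g : iter p d (f + g) = iter p d f + iter p d g.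
Proof.
have := iter_koszul_d_sum p [:: f; g] id.
by rewrite !big_cons !big_nil !addr0.
Qed.

Lemma iter_koszul_d0 p : iter p d 0 = 0.
Proof. by elim: p => //= p ->; rewrite raddf0. Qed.

Lemma koszul0 n m : koszul N R n m 0.
Proof. by case: m => //= m; case: ifP => // _; apply: sums0. Qed.

Lemma tpow_sandwich_tpow r s t : tpow_sandwich R r s t -> t \in tpow E (r + N + s).
Proof.
move: t; apply: sums_ind; [exact: rpred0|exact: rpredD|].
by move=> _ [a [b [c [ar /R_homog bN cs ->]]]]; rewrite !tpowM.
Qed.

Lemma dualcomp_tpow m t : dualcomp N R m t -> t \in tpow E m.
Proof.
rewrite /dualcomp; case: ltnP => // Nm /(_ 0%N (m - N)%N erefl).
by move/tpow_sandwich_tpow; rewrite add0n subnKC.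
Qed.

(** For u of degree n - m, d^(n-m) (1 (x) u v) is the class of u tensored with v. The shape of the
    lift is kept because [acyclic_shift] needs it in E (x) R. *)
Lemma koszul_lift n m f : (m <= n)%N -> koszul N R n m f ->
  exists2 t, sums (fun z => exists u v,
      [/\ u \in tpow E (n - m), dualcomp N R m v & z = u * v]) t
    & f = iter (n - m) d (tens 1 t).
Proof.
move=> mn; rewrite /koszul mn; move: f.
apply: sums_ind => [|f g [t tS ->] [u uS ->]|_ [_ [v [[u um ->] vm ->]]]].
- by exists 0; [exact: sums0|rewrite tens0r iter_koszul_d0].
- by exists (t + u); [exact: sumsD|rewrite tensDr iter_koszul_dD].
exists (u * v); first by apply: sums_gen; exists u, v.
by rewrite (iter_koszul_d 1 v um) mul1r.
Qed.

Lemma koszul_lift_tpow n m f : (m <= n)%N -> koszul N R n m f ->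
  exists2 t, t \in tpow E n & f = iter (n - m) d (tens 1 t).
Proof.
move=> mn /(koszul_lift mn)[t tS ->]; exists t => //.
move: t tS; apply: sums_ind; [exact: rpred0|exact: rpredD|].
by move=> _ [u [v [um /dualcomp_tpow vm ->]]]; rewrite -(subnK mn) tpowM.
Qed.

Lemma iter_koszul_d_koszul n m t : (m <= n)%N ->
  (forall v, v \in tpow E m -> dualcomp N R m v) -> t \in tpow E n ->
  koszul N R n m (iter (n - m) d (tens 1 t)).
Proof.
move=> mn full tn; rewrite /koszul mn.
move: tn; rewrite -{1}(subnK mn) => /tpow_split; move: t.
apply: sums_ind => [|x y Hx Hy|_ [u [v [um vm ->]]]].
- by rewrite tens0r iter_koszul_d0; apply: sums0.
- by rewrite tensDr iter_koszul_dD; apply: sumsD.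
rewrite (iter_koszul_d 1 v um) mul1r; apply: sums_gen.
by exists (algpi R u), v; split=> //; [exists u|exact: full].
Qed.

Lemma iter_koszul_d_lead k (a : algquot R) t w :
  (iter k d (tens a t))@_w = a * algpi R (tenslead k t w).
Proof.
elim: k a t => [|k IH] a t /=.
  by rewrite tensE linearZ /= rmorph1 -algquot_scalerAr mulr1.
rewrite -iterS iterSr koszul_d_tensdiv iter_koszul_d_sum !raddf_sum mulr_sumr /=.
by apply: eq_bigr => i _; rewrite IH rmorphM mulrA.
Qed.

(** The coefficient of d^k (1 (x) t) at [w] is the class of [tenslead k t w], and the hypothesis
    makes E^(x)k -> A_k injective. *)
Lemma iter_koszul_d_inj k m t :
  (forall u, u \in tsideal R -> u \in tpow E k -> u = 0) ->
  t \in tpow E (k + m) -> iter k d (tens 1 t) = 0 -> t = 0.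
Proof.
move=> inj tkm t0; apply: (tenslead_eq0 tkm) => w.
apply: inj (tenslead_tpow _ _ _); apply/algpi_eq0.
by have := iter_koszul_d_lead k 1 t w; rewrite t0 mcoeff0 mul1r.
Qed.

(** Write f = d^(n-m) (1 (x) t) and stop q steps earlier; fullness in degree m + q keeps the
    intermediate element in the complex. *)
Lemma koszul_preimage n m q f : (m + q <= n)%N ->
  (forall v, v \in tpow E (m + q) -> dualcomp N R (m + q) v) ->
  koszul N R n m f ->
  exists2 g, koszul N R n (m + q)%N g & iter q d g = f.
Proof.
move=> mqn full; have mn := leq_trans (leq_addr q m) mqn.
move=> /(koszul_lift_tpow mn)[t tn ->].
exists (iter (n - (m + q)) d (tens 1 t)); first exact: iter_koszul_d_koszul.
by rewrite -iterD subnDA subnKC // leq_subRL.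
Qed.

(** With f = d^(n-m) (1 (x) t), one has d^p f = d^(p+n-m) (1 (x) t), so injectivity in degree p + n
    - m forces t = 0. *)
Lemma koszul_ker_eq0 n m p f : (p <= m <= n)%N ->
  (forall u, u \in tsideal R -> u \in tpow E (p + (n - m)) -> u = 0) ->
  koszul N R n m f -> iter p d f = 0 -> f = 0.
Proof.
move=> /andP[pm mn] inj /(koszul_lift_tpow mn)[t tn ->].
rewrite -iterD => /(iter_koszul_d_inj (m := m - p) inj) ->.
  by rewrite tens0r iter_koszul_d0.
by rewrite addnAC subnKC // subnKC.
Qed.

Lemma acyclic_nat n :
  (forall (m p : nat) f, (m <= n)%N -> (0 < p < N)%N -> koszul N R n m f ->
     iter p d f = 0 ->
     f = 0 \/ exists2 g, koszul N R n (m + (N - p))%N g & iter (N - p) d g = f) ->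
  acyclic N (koszul N R n) d.
Proof.
move=> H m p p_int f fm f0.
have triv : f = 0 -> exists2 g, koszul N R n (m + (N - p)%N%:Z) g
    & iter (N - p) d g = f.
  by move=> ->; exists 0; [exact: koszul0|exact: iter_koszul_d0].
case: m fm triv => [m|m] fm triv; last exact: triv fm.
have [mn|nm] := leqP m n; last by apply: triv; move: fm; rewrite /= leqNgt nm.
by have [/triv|] := H m p f mn p_int fm f0.
Qed.

(** * Acyclicity in the two extreme cases *)

Lemma acyclic_trivial n : R =i pred1 0 -> (N.-1 <= n)%N ->
  acyclic N (koszul N R n) d.
Proof.
move=> R0 Nn; apply: acyclic_nat => m p f mn /andP[p0 pN] fm f0.
have I0 k u : u \in tsideal R -> u \in tpow E k -> u = 0.
  move=> /tsidealP uI _; move: u uI; apply: sums_ind => // [x y -> ->|].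
    exact: addr0.
  by move=> _ [a [s [b [+ ->]]]]; rewrite R0 => /eqP->; rewrite mulr0 mul0r.
have [pm|mp] := leqP p m.
  by left; apply: koszul_ker_eq0 fm f0; rewrite ?pm //; apply: I0.
(* The target degree is below N, where the dual component is all of the tensor power, and n >= N - 1
   keeps it at most n. *)
have mpN : (m + (N - p) < N)%N by rewrite -[ltnRHS](subnKC (ltnW pN)) ltn_add2r.
right; apply: koszul_preimage fm => [|v]; last by rewrite /dualcomp mpN.
by apply: leq_trans Nn; case: (N) mpN.
Qed.

Lemma acyclic_full n : R =i tpow E N -> (N.-1 <= n)%N ->
  acyclic N (koszul N R n) d.
Proof.
move=> RT Nn; apply: acyclic_nat => m p f mn /andP[p0 pN] fm f0.
have full k v : v \in tpow E k -> dualcomp N R k v.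
  rewrite /dualcomp; case: ltnP => // Nk vk r s rs.
  have: v \in tpow E (r + (N + s)) by rewrite addnCA rs subnKC.
  move=> /tpow_split; move: v {vk}.
  apply: sums_ind => [|x y|_ [a [u [ar us ->]]]].
  - exact: sums0.
  - exact: sumsD.
  have := tpow_split us; move: u {us}; apply: sums_ind => [|x y Hx Hy|].
  - by rewrite mulr0; apply: sums0.
  - by rewrite mulrDr; apply: sumsD.
  move=> _ [b [c [bN cs ->]]]; apply: sums_gen.
  by exists a, b, c; rewrite RT mulrA.
(* In the first case d^p lands where the ideal is still zero, so it is injective. Otherwise m + N -
   p <= n and f has a preimage: m < p together with p + n - m < N would give n < N - 1. *)
have [small|large] := boolP ((p <= m) && (p + (n - m) < N))%N.
  case/andP: small => pm small; left; apply: koszul_ker_eq0 fm f0.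
    by rewrite pm.
  by move=> u; apply: tsideal_low.
right; apply: koszul_preimage fm; last exact: full.
rewrite -leq_subRL // leq_subLR leqNgt; apply: contra large => large.
rewrite large andbT leqNgt; apply/negP => mp.
have : (n < p + (n - m))%N by rewrite -{1}(subnKC mn) ltn_add2r.
by move=> /leq_ltn_trans/(_ large); rewrite ltnNge (leq_trans (leqSpred N)).
Qed.

(** * From acyclicity to R = 0 or R = E^(x)N *)

Hypothesis R_subspace : submod_closed R.

Lemma R_addr x y : x \in R -> y \in R -> x + y \in R.
Proof. by case: R_subspace => _ lin xR yR; rewrite -[x]scale1r lin. Qed.

Lemma R_scale c x : x \in R -> c *: x \in R.
Proof. by case: R_subspace => R0 lin xR; rewrite -[_ *: _]addr0 lin. Qed.

Lemma dualcomp_R t : dualcomp N R N t -> t \in R.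
Proof.
rewrite /dualcomp ltnn subnn => /(_ 0%N 0%N erefl); move: t.
apply: sums_ind => [||_ [a [b [c [a0 bR c0 ->]]]]].
- by case: R_subspace.
- exact: R_addr.
rewrite (tpow0_scalar a0) (tpow0_scalar c0) -scalerAl mul1r -scalerAr mulr1.
by do 2!apply: R_scale.
Qed.

(** This is the inclusion of R (x) E in E (x) R, read letter by letter. *)
Lemma acyclic_shift r i j : (3 <= N)%N -> acyclic N (koszul N R N.+1) d ->
  r \in R -> tensdiv i (r * tensX j) \in R.
Proof.
move=> N3 acyc rR; set t := r * tensX j.
have tN : t \in tpow E N.+1.
  by rewrite -addn1; apply: tpowM (tensX_tpow j); apply: R_homog.
have N0 : (0 < N)%N by apply: leq_trans N3.
have N2 : (N.+1 - N.-1 = 2)%N by rewrite -{1}(prednK N0) -addn2 addKn.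
have f_in : koszul N R N.+1 N.-1 (iter 2 d (tens 1 t)).
  rewrite -N2; apply: iter_koszul_d_koszul => //.
    by rewrite -{2}(prednK N0) leqW.
  by move=> v; rewrite /dualcomp prednK // leqnn.
(* The first N of these N + 1 applications of d already turn [r] into its class in A, which is 0. *)
have f0 : iter N.-1 d (iter 2 d (tens 1 t)) = 0.
  rewrite -iterD addn2 prednK // iterS -[tens 1 t]/(tens 1 (r * tensX j)).
  rewrite (iter_koszul_d 1 (tensX j) (R_homog rR)) mul1r.
  have /algpi_eq0-> : r \in tsideal R.
    by apply/tsidealP/sums_gen; exists 1, r, 1; rewrite mul1r mulr1.
  rewrite (_ : tens 0 _ = 0) ?raddf0 //.
  by apply/malgP => w; rewrite tensE scaler0 mcoeff0.
have [|y] := acyc N.-1 N.-1 _ _ f_in f0.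
  by rewrite -subn1 subn_gt0 subn1 ltn_predL N0 (ltnW N3).
have -> : (N - N.-1 = 1)%N by rewrite -{1}(prednK N0) subSnn.
have -> : (N.-1%:Z + 1%N%:Z) = N%:Z by rewrite -PoszD addn1 prednK.
move=> /(koszul_lift (leqnSn N))[t' t'S ->]; rewrite subSnn -iterD => eq_d2.
(* [t'] lies in E (x) R by construction. It equals [t] because both have the same image under d^2,
   which is injective on lifts since 2 < N. *)
suff <- : t' = t.
  move: t' t'S {eq_d2}; apply: sums_ind => [|x z xR zR|_ [u [v [u1 vR ->]]]].
  - by rewrite raddf0; case: R_subspace.
  - by rewrite raddfD R_addr.
  rewrite subSnn in u1; rewrite (tensdivM i v u1).
  rewrite (tpow0_scalar (tensdiv_tpow i u1)) -scalerAl mul1r.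
  exact/R_scale/dualcomp_R.
have t'N : t' \in tpow E N.+1.
  move: t' t'S {eq_d2}; apply: sums_ind; [exact: rpred0|exact: rpredD|].
  by move=> _ [u [v [um /dualcomp_tpow vm ->]]]; rewrite -(subnK (leqnSn N)) tpowM.
apply/eqP; rewrite -subr_eq0; apply/eqP.
apply: (@iter_koszul_d_inj 2 N.-1) => [u uI u2||].
- exact: tsideal_low uI u2.
- by rewrite addnC addn2 prednK //; apply: rpredB.
- have -> : t' - t = t' + (-1) *: t by rewrite scaleN1r.
  rewrite tensDr iter_koszul_dD eq_d2 -iter_koszul_dD -tensDr scaleN1r subrr.
  by rewrite tens0r iter_koszul_d0.
Qed.

Lemma shift_full r : (forall r i j, r \in R -> tensdiv i (r * tensX j) \in R) ->
  r \in R -> r != 0 -> (0 < N)%N -> R =i tpow E N.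
Proof.
move=> shift rR r0 N0 v; apply/idP/idP => [/R_homog //|vN].
have [w rw] : exists w, r@_w != 0.
  apply/not_existsP => rw; case/eqP: r0; apply/malgP => w.
  by rewrite mcoeff0; apply/eqP/negPn/negP/rw.
have wN : fdeg w = N.
  by apply/eqP; apply: contraNT rw => /(tpowP _ _ (R_homog rR)) ->.
rewrite (tensalg_wordE v) big_seq.
apply: (big_ind (fun x => x \in R)) => [||u]; [by case: R_subspace|exact: R_addr|].
move=> /(allP vN)/eqP uN; apply: R_scale.
pose contract := foldl (fun t i => @tensdiv K E i t).
(* Appending a letter on the right and stripping one on the left alternate, so each round stays in R
   by [shift]. *)
have contractM (s s' : seq 'I_(\dim {:E})) x : size s = size s' -> x \in R ->
    contract (x * \prod_(i <- s') tensX i) s \in R.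
  elim: s s' x => [|i s IH] [|j s'] //= x; first by rewrite big_nil mulr1.
  case=> ss xR; rewrite big_cons mulrA (@tensdivM _ _ i N).
    by apply: IH => //; apply: shift.
  by rewrite -addn1; apply: tpowM (tensX_tpow j); apply: R_homog.
have contract_full (s : seq 'I_(\dim {:E})) x y : x \in tpow E (size s) ->
    contract (x * y) s = x@_(FMonom s) *: y.
  elim: s x => [|i s IH] x xs /=.
    rewrite {1}(tpow0_scalar xs) -scalerAl mul1r; congr (_@__ *: _).
    by apply/val_inj; rewrite /= fm1.
  by rewrite (tensdivM i y xs) IH ?tensdivE ?(tensdiv_tpow _ xs).
have sw : size w = N by rewrite -wN fdegE.
have su : size u = N by rewrite -uN fdegE.
(* Contracting r u along [w] gives [r@_w] times [u], and [r@_w] is invertible, so the word [u] is in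
   R. *)
have := contractM w u r (etrans sw (esym su)) rR.
rewrite contract_full ?sw ?R_homog // -word_prod => /(R_scale (r@_w)^-1).
have -> : FMonom w = w by apply/val_inj.
by rewrite scalerA mulVf // scale1r.
Qed.

End KoszulComplex.

Theorem corollary1 (K : fieldType) (E : vectType K) (N : nat)
    (R : {pred tensalg E}) (N_ge3 : (3 <= N)%N)
    (R_subspace : submod_closed R) (R_homog : {subset R <= tpow E N}) :
  (forall n : nat, (N.-1 <= n)%N -> acyclic N (koszul N R n) (@koszul_d K E R))
  <-> (R =i pred1 0) \/ (R =i tpow E N).
Proof.
split=> [acyc|[R0|RT] n Nn]; last exact: acyclic_full.
  have [[r [rR r0]]|Rtriv] := pselect (exists r, r \in R /\ r != 0).
    right; apply: shift_full rR r0 (leq_trans _ N_ge3) => // s i j sR.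
    apply: (acyclic_shift R_homog) sR => //; apply: acyc.
    exact: leq_trans (leq_pred N) (leqnSn N).
  left=> x; rewrite inE; apply/idP/eqP => [xR|->]; last by case: R_subspace.
  by apply/eqP/negPn/negP => x0; apply: Rtriv; exists x.
exact: acyclic_trivial.
Qed.
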